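(* There exists an undecidable iterative propositional calculus; that is, there exist a finite set $\Sigma$ of logical connectives and a finite set $P$ of $\Sigma$-formulas such that, for the iterative propositional calculus with axioms $P$, there is no algorithm which, given an arbitrary $\Sigma$-formula $A$, decides whether $P \vdash A$.
   Context: Let $\mathcal{V}$ be a countably infinite set of propositional variables and $\Sigma$ a finite set of logical connectives (the signature; typically the connectives are unary or binary, e.g. $\neg,\vee,\wedge,\to$), containing the binary connective $\to$. $\Sigma$-formulas are built from variables and connectives of $\Sigma$ in the usual way. An iterative propositional calculus $P$ over $\Sigma$ consists of a finite set $P$ of $\Sigma$-formulas, called axioms, together with two inference rules: (1) modus ponens: from $A$ and $A\to B$ infer $B$; (2) superposition (the system of Maltsev operations): from $A(x)$ and $B$ infer $A(B)$, where $x$ is a variable and $A(B)$ is obtained by replacing all occurrences of $x$ in $A$ by $B$ (so the substituted formula $B$ must itself already be derived); the Maltsev operations also include renaming and identification of variables, i.e. from $A(x)$ one may infer $A(y)$ for any variables $x,y$. $P\vdash A$ means that $A$ is obtained from the axioms by finitely many applications of these rules. The calculus is decidable if there is an algorithm that, for an arbitrary formula $A$, answers whether $P\vdash A$; otherwise it is undecidable. *)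

(* Defs.v *)
From Stdlib Require List.
From mathcomp Require Import all_boot.
Set Implicit Arguments.
Unset Strict Implicit.
Unset Printing Implicit Defensive.

(** * Formulas *)

Record signature := Signature {
  conn : finType;
  arity : conn -> nat;
  imp : conn;
  arity_imp : arity imp = 2
}.

(** The countably infinite set of propositional variables is [nat]. *)
Inductive formula (S : signature) : Type :=
| Var of nat
| App (c : conn S) of {ffun 'I_(arity c) -> formula S}.
Arguments Var {S} _.

(** Since [arity (imp S) = 2], the index [i] below takes exactly the values
    0 (antecedent) and 1 (consequent). *)
Definition Imp (S : signature) (A B : formula S) : formula S :=
  App [ffun i : 'I_(arity (imp S)) => if i == 0 :> nat then A else B].

(** [subst x B A] replaces all occurrences of the variable [x] in [A] by [B]. *)
Fixpoint subst (S : signature) (x : nat) (B A : formula S) : formula S :=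
  match A with
  | Var y => if y == x then B else Var y
  | App c args => App [ffun i : 'I_(arity c) => subst x B (args i)]
  end.

(** * Iterative propositional calculi *)

(** In [derives_superposition] the substituted formula must itself be derived;
    [derives_renaming] covers both renaming and identification of variables. *)
Inductive derives (S : signature) (P : seq (formula S)) : formula S -> Prop :=
| derives_axiom A : List.In A P -> derives P A
| derives_modus_ponens A B :
    derives P A -> derives P (Imp A B) -> derives P B
| derives_superposition x A B :
    derives P A -> derives P B -> derives P (subst x B A)
| derives_renaming x y A :
    derives P A -> derives P (subst x (Var y) A).

(** * Algorithms: partial recursive functions *)

(** [murec k] is the syntax of [k]-ary partial recursive functions. *)
Inductive murec : nat -> Type :=
| MZero k : murec k
| MSucc : murec 1
| MProj k (i : 'I_k) : murec k
| MComp k m (f : murec m) (g : 'I_m -> murec k) : murec k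
| MRec k (f : murec k) (g : murec k.+2) : murec k.+1
| MMin k (f : murec k.+1) : murec k.

(** [primrec f g n v y]: the function [h] with [h(0, v) = f(v)] and
    [h(n + 1, v) = g(n, h(n, v), v)] has value [y] at [(n, v)], where [f] and
    [g] are given by their graphs. *)
Fixpoint primrec k (f : k.-tuple nat -> nat -> Prop)
    (g : k.+2.-tuple nat -> nat -> Prop) (n : nat) (v : k.-tuple nat)
    (y : nat) : Prop :=
  match n with
  | 0 => f v y
  | n'.+1 => exists2 r, primrec f g n' v r & g [tuple of n' :: r :: v] y
  end.

(** [computes f v y]: the evaluation of [f] on [v] terminates with value [y].
    For [MMin], [f] must be defined and nonzero at every smaller argument. *)
Fixpoint computes k (f : murec k) : k.-tuple nat -> nat -> Prop :=
  match f in murec k return k.-tuple nat -> nat -> Prop with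
  | MZero _ => fun _ y => y = 0
  | MSucc => fun v y => y = (thead v).+1
  | MProj _ i => fun v y => y = tnth v i
  | MComp _ m f g => fun v y =>
      exists2 w : m.-tuple nat,
        forall i, computes (g i) v (tnth w i) & computes f w y
  | MRec _ f g => fun v y =>
      primrec (computes f) (computes g) (thead v) [tuple of behead v] y
  | MMin _ f => fun v y =>
      computes f [tuple of y :: v] 0 /\
      forall z, z < y -> exists r, computes f [tuple of z :: v] r.+1
  end.

(** * Decidability *)

(** Goedel numbering of formulas, through the bijection
    [CodeSeq.code : seq nat -> nat]. *)
Fixpoint godel (S : signature) (A : formula S) : nat :=
  match A with
  | Var x => CodeSeq.code [:: 0; x]
  | App c args =>
      CodeSeq.code ((enum_rank c).+1 :: codom (fun i => godel (args i)))
  end.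

(** The algorithm halts on every formula [A], answering 1 or 0. *)
Definition decidable_calculus (S : signature) (P : seq (formula S)) : Prop :=
  exists f : murec 1, forall A : formula S,
    exists b : bool, computes f [tuple godel A] b /\ (b <-> derives P A).

(* Main.v *)
Require Import Defs.
From HB Require Import structures.
From mathcomp Require Import all_boot.
Set Implicit Arguments.
Unset Strict Implicit.
Unset Printing Implicit Defensive.

(** Substitution may only insert derivable formulas, but it suffices that
    every piece of data is derivable. The calculus has a constant [CNil] and a
    binary connective [CPair], with axioms [nil] and [pair(x, y)]; by
    superposition every closed tree built from them is derivable, hence can be
    substituted for a variable. A ternary connective [CEval] expresses
    judgments about trees, and a Horn clause between judgments becomes an axiom
    through nested implications: superposition instantiates its variables by
    trees and modus ponens discharges its premises ([derivable_closed]).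
    Conversely, interpreting each formula as a tree together with a truth value
    gives a logical matrix in which all theorems are true, so nothing is
    derivable about closed trees beyond what the clauses force
    ([derivable_least]). Iterative calculi thus embed Horn programs over trees.

    The Horn program used here is a big-step evaluator: partial recursive
    functions are compiled to trees, and the judgment (p, v, y) says that the
    program p returns y on the input v. Evaluation simulates [computes]
    ([Ev_compile]) and is deterministic ([Ev_functional]), so once a program is
    known to return a value, judgments giving it another value are not
    derivable.

    Undecidability follows by diagonalization. The Goedel number of the formula
    saying that p returns 0 on the Goedel number of p is a recursive function of
    the latter ([computes_self_query]). If f decided the calculus, let p be the
    program that runs f on this formula. If f answers 0, then p returns 0, the
    formula is derivable, and f should have answered 1. If f answers 1, then the
    formula is derivable, so p returns 0 as well as 1, against determinism. *)

(** * Trees and Horn clauses *)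

(** Leaves are the variables: [nat] in clauses, [void] in closed trees. *)
Inductive tree (X : Type) : Type :=
| Leaf of X
| Nil
| Pair of tree X & tree X.
Arguments Nil {X}.

Definition data := tree void.
Definition pattern := tree nat.

Fixpoint bind X Y (s : X -> tree Y) (t : tree X) : tree Y :=
  match t with
  | Leaf x => s x
  | Nil => Nil
  | Pair a b => Pair (bind s a) (bind s b)
  end.

Fixpoint below n (t : pattern) : bool :=
  match t with
  | Leaf x => x < n
  | Nil => true
  | Pair a b => below n a && below n b
  end.

Record judgment X :=
  Judgment { prog : tree X; input : tree X; output : tree X }.

Definition instance (s : nat -> data) (j : judgment nat) : judgment void :=
  Judgment (bind s (prog j)) (bind s (input j)) (bind s (output j)).

Definition judgment_below n (j : judgment nat) : bool :=
  [&& below n (prog j), below n (input j) & below n (output j)].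

(** Premises and conclusion. *)
Definition clause := (seq (judgment nat) * judgment nat)%type.

Definition clause_below n (c : clause) : bool :=
  all (judgment_below n) c.1 && judgment_below n c.2.

Definition closed_under (R : judgment void -> Prop) (c : clause) : Prop :=
  forall s : nat -> data,
    foldr (fun j Q => R (instance s j) -> Q) (R (instance s c.2)) c.1.

(** * The signature *)

Inductive connective := CImp | CNil | CPair | CEval.

Definition connective_index (c : connective) : 'I_4 :=
  inord (match c with CImp => 0 | CNil => 1 | CPair => 2 | CEval => 3 end).

Definition index_connective (i : 'I_4) : connective :=
  nth CEval [:: CImp; CNil; CPair] i.

Lemma connective_indexK : cancel connective_index index_connective.
Proof. by case; rewrite /index_connective inordK. Qed.

HB.instance Definition _ :=
  Finite.copy connective (can_type connective_indexK).

Definition tsig : signature :=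
  @Signature connective
    (fun c => match c with CNil => 0 | CEval => 3 | _ => 2 end) CImp erefl.

(** Locked so that simplification keeps [subst], [godel] and [interp] applied
    to [app] intact, for the equations below to rewrite. *)
HB.lock Definition app (c : conn tsig) (s : seq (formula tsig)) :
    formula tsig :=
  App [ffun i : 'I_(arity c) => nth (Var 0) s i].

Definition fEval p v y : formula tsig := app CEval [:: p; v; y].

Fixpoint fm X (f : X -> nat) (t : tree X) : formula tsig :=
  match t with
  | Leaf x => Var (f x)
  | Nil => app CNil [::]
  | Pair a b => app CPair [:: fm f a; fm f b]
  end.

Definition judgment_fm X (f : X -> nat) (j : judgment X) : formula tsig :=
  fEval (fm f (prog j)) (fm f (input j)) (fm f (output j)).

Definition clause_fm (c : clause) : formula tsig :=
  foldr (fun j A => Imp (judgment_fm id j) A) (judgment_fm id c.2) c.1.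

Definition data_fm : data -> formula tsig := fm (of_void nat).
Definition ground_fm : judgment void -> formula tsig :=
  judgment_fm (of_void nat).

Definition axioms (H : seq clause) : seq (formula tsig) :=
  app CNil [::] :: app CPair [:: Var 0; Var 1] :: map clause_fm H.

(** The generated induction principle gives no hypothesis on the arguments of
    a connective, since they are nested under a finite function. *)
Lemma formula_args_ind (S : signature) (Q : formula S -> Prop) :
  (forall x, Q (Var x)) ->
  (forall c (args : {ffun 'I_(arity c) -> formula S}),
     (forall i, Q (args i)) -> Q (App args)) ->
  forall A, Q A.
Proof.
move=> QV QA; fix IH 1; case=> [x|c args]; first exact: QV.
by apply: QA => i; apply: IH.
Qed.

(** Both [godel] and [interp] recurse through the [codom] of the arguments. *)
Lemma codom_args T (f : formula tsig -> T) (c : conn tsig) s :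
  size s = arity c ->
  codom (fun i => f ([ffun i : 'I_(arity c) => nth (Var 0) s i] i)) = map f s.
Proof.
move=> sz; rewrite codomE.
rewrite (eq_map (g := (f \o nth (Var 0) s) \o val)); last first.
  by move=> i; rewrite /= ffunE.
by rewrite map_comp val_enum_ord -sz map_comp -/(mkseq _ _) mkseq_nth.
Qed.

Lemma Imp_app A B : Imp A B = app CImp [:: A; B].
Proof.
rewrite app.unlock; congr App; apply/ffunP=> -[[|[|k]] lt_k2] //;
  by rewrite !ffunE.
Qed.

Lemma subst_app x B (c : conn tsig) s : size s = arity c ->
  subst x B (app c s) = app c (map (subst x B) s).
Proof.
move=> sz; rewrite app.unlock; congr App; apply/ffunP=> i; rewrite !ffunE.
by rewrite (nth_map (Var 0)) // sz.
Qed.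

Lemma godel_app (c : conn tsig) s : size s = arity c ->
  godel (app c s) = CodeSeq.code ((enum_rank c).+1 :: map (@godel tsig) s).
Proof. by move=> sz; rewrite app.unlock /= codom_args. Qed.

(** * Derivable instances of clauses *)

Lemma subst_data x B (t : data) : subst x B (data_fm t) = data_fm t.
Proof.
elim: t => [[]||a IHa b IHb]; rewrite /data_fm /= subst_app //=.
by rewrite -!/(data_fm _) IHa IHb.
Qed.

Section Calculus.
Variable H : seq clause.
Let P := axioms H.

Definition derivable (j : judgment void) : Prop := derives P (ground_fm j).

(** Closedness of the trees makes the second superposition leave the first
    inserted tree unchanged. *)
Lemma derives_data (t : data) : derives P (data_fm t).
Proof.
elim: t => [[]||a IHa b IHb]; first by apply: derives_axiom; left.
have ax : derives P (app CPair [:: Var 0; Var 1]).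
  by apply: derives_axiom; right; left.
have := derives_superposition 1 (derives_superposition 0 ax IHa) IHb.
by rewrite !subst_app //= subst_data.
Qed.

Section Instantiate.
Variable s : nat -> data.

(** One variable at a time, as in the superposition rule; on formulas whose
    variables are below [n] this is the simultaneous substitution of [s],
    because the inserted trees are closed. *)
Fixpoint instantiate n (A : formula tsig) : formula tsig :=
  if n is k.+1 then subst k (data_fm (s k)) (instantiate k A) else A.

Lemma derives_instantiate n A : derives P A -> derives P (instantiate n A).
Proof.
move=> dA; elim: n => //= n IHn.
exact: derives_superposition IHn (derives_data _).
Qed.

Lemma instantiate_app n (c : conn tsig) (l : seq (formula tsig)) :
  size l = arity c ->
  instantiate n (app c l) = app c (map (instantiate n) l).
Proof.
move=> sz; elim: n => [|n IHn] /=; first by rewrite map_id.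
by rewrite IHn subst_app ?size_map // -map_comp.
Qed.

Lemma instantiate_var n x :
  instantiate n (Var x) = if x < n then data_fm (s x) else Var x.
Proof.
elim: n => //= n ->; rewrite ltnS [x <= n]leq_eqVlt.
case: (ltngtP x n) => [_|ltnx|->] /=; first exact: subst_data.
  by rewrite gtn_eqF.
by rewrite eqxx.
Qed.

Lemma instantiate_pattern n (t : pattern) : below n t ->
  instantiate n (fm id t) = data_fm (bind s t).
Proof.
elim: t => [x||a IHa b IHb] /=.
- by rewrite instantiate_var => ->.
- by rewrite instantiate_app.
by case/andP=> lta ltb; rewrite instantiate_app //= IHa // IHb.
Qed.

Lemma instantiate_judgment n (j : judgment nat) : judgment_below n j ->
  instantiate n (judgment_fm id j) = ground_fm (instance s j).
Proof.
case/and3P=> ltp ltv lty.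
by rewrite /judgment_fm /fEval instantiate_app //= !instantiate_pattern.
Qed.

End Instantiate.

(** Completeness: derivability obeys the clauses. The instance of the axiom is
    derivable because trees are, and modus ponens removes its premises. *)
Lemma derivable_closed n c :
  clause_below n c -> List.In c H -> closed_under derivable c.
Proof.
move=> ltcn Hc s.
have: derives P (clause_fm c).
  by apply: derives_axiom; right; right; apply: List.in_map.
move/(derives_instantiate s n).
case: c ltcn {Hc} => js j /andP[/=]; rewrite /clause_fm /=.
elim: js => [_ ltj|j' js IHjs /= /andP[ltj' ltjs] ltj] /=.
  by rewrite instantiate_judgment.
rewrite Imp_app instantiate_app //= -Imp_app instantiate_judgment // => d d'.
by apply: IHjs => //; apply: derives_modus_ponens d.
Qed.

(** * Soundness *)

Section Soundness.
Variable R : judgment void -> Prop.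
Hypothesis R_closed : forall c, List.In c H -> closed_under R c.

(** The matrix: a formula denotes a tree, meaningful when it is used as data,
    and a proposition, meaningful when it is used as an assertion. *)
Definition value := (data * Prop)%type.

Definition op (c : connective) (vs : seq value) : value :=
  match c, vs with
  | CImp, [:: a; b] => (Nil, a.2 -> b.2)
  | CPair, [:: a; b] => (Pair a.1 b.1, True)
  | CEval, [:: p; v; y] => (Nil, R (Judgment p.1 v.1 y.1))
  | _, _ => (Nil, True)
  end.

Fixpoint interp (r : nat -> value) (A : formula tsig) : value :=
  match A with
  | Var x => r x
  | App c args => op c (codom (fun i => interp r (args i)))
  end.

Lemma interp_app r (c : conn tsig) s : size s = arity c ->
  interp r (app c s) = op c (map (interp r) s).
Proof. by move=> sz; rewrite app.unlock /= codom_args. Qed.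

Lemma interp_subst r x B A :
  interp r (subst x B A) =
  interp (fun y => if y == x then interp r B else r y) A.
Proof.
elim/formula_args_ind: A => [y|c args IH] /=; first by case: eqP.
by congr op; apply: eq_codom => i; rewrite ffunE.
Qed.

Lemma interp_fm X (f : X -> nat) r t :
  (interp r (fm f t)).1 = bind (fun x => (r (f x)).1) t.
Proof.
elim: t => [x||a IHa b IHb] //=; rewrite interp_app //=.
by rewrite IHa IHb.
Qed.

Lemma interp_pattern r j :
  (interp r (judgment_fm id j)).2 = R (instance (fun x => (r x).1) j).
Proof. by rewrite interp_app //= !interp_fm. Qed.

Lemma interp_clause r c : List.In c H -> (interp r (clause_fm c)).2.
Proof.
move/R_closed/(_ (fun x => (r x).1)); case: c => js j; rewrite /clause_fm /=.
elim: js => [|j' js IHjs]; first by rewrite interp_pattern.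
rewrite [X in interp r X]/= Imp_app interp_app //= interp_pattern => Rj Rj'.
exact/IHjs/Rj.
Qed.

(** A theorem is true under every valuation: clauses hold for all trees, and a
    substitution instance is evaluated by changing the valuation. *)
Lemma derives_sound A : derives P A -> forall r, (interp r A).2.
Proof.
elim=> {A} [A [<-|[<-|HA]]|A B _ IHA _ IHB|x A B _ IHA _ _|x y A _ IHA] r.
- by rewrite interp_app.
- by rewrite interp_app.
- have [c [<- Hc]] := iffLR (List.in_map_iff _ _ _) HA.
  exact: interp_clause.
- by have := IHB r; rewrite Imp_app interp_app //=; apply.
- by rewrite interp_subst.
by rewrite interp_subst.
Qed.

(** Soundness: the valuation is irrelevant to a closed judgment, which denotes
    itself in the matrix, with truth value given by [R]. *)
Lemma derivable_least j : derivable j -> R j.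
Proof.
move/derives_sound/(_ (fun=> (Nil, True))).
rewrite interp_app //= !interp_fm.
have bind_data (t : data) : bind (fun=> Nil) t = t.
  by elim: t => [[]||a IHa b IHb] //=; rewrite IHa IHb.
by rewrite !bind_data; case: j.
Qed.

End Soundness.
End Calculus.

(** * An evaluator *)

Definition num X k : tree X := iter k (Pair Nil) Nil.
Arguments num {X} k.

(** Programs take the list of arguments as input. [pcons p q] returns the
    list whose head is the result of [p] and whose tail is that of [q];
    [psearch p] looks for the least zero of [p] from the first argument on. *)
Definition instr X k (p q : tree X) : tree X := Pair (num k) (Pair p q).
Definition pzero {X} : tree X := instr 0 Nil Nil.
Definition psucc {X} : tree X := instr 1 Nil Nil.
Definition phead {X} : tree X := instr 2 Nil Nil.
Definition ptail X (p : tree X) := instr 3 p Nil.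
Definition pcons X (p q : tree X) := instr 4 p q.
Definition pcomp X (p q : tree X) := instr 5 p q.
Definition prec X (p q : tree X) := instr 6 p q.
Definition pmin X (p : tree X) := instr 7 p Nil.
Definition psearch X (p : tree X) := instr 8 p Nil.

Inductive Ev : data -> data -> data -> Prop :=
| Ev_zero v : Ev pzero v Nil
| Ev_succ x v : Ev psucc (Pair x v) (Pair Nil x)
| Ev_head x v : Ev phead (Pair x v) x
| Ev_tail p x v y : Ev p v y -> Ev (ptail p) (Pair x v) y
| Ev_cons p q v x y : Ev p v x -> Ev q v y -> Ev (pcons p q) v (Pair x y)
| Ev_comp p q v w y : Ev q v w -> Ev p w y -> Ev (pcomp p q) v y
| Ev_rec0 p q v y : Ev p v y -> Ev (prec p q) (Pair Nil v) y
| Ev_recS p q x v r y :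
    Ev (prec p q) (Pair x v) r -> Ev q (Pair x (Pair r v)) y ->
    Ev (prec p q) (Pair (Pair Nil x) v) y
| Ev_min p v y : Ev (psearch p) (Pair Nil v) y -> Ev (pmin p) v y
| Ev_found p x v : Ev p (Pair x v) Nil -> Ev (psearch p) (Pair x v) x
| Ev_next p x v r y :
    Ev p (Pair x v) (Pair Nil r) -> Ev (psearch p) (Pair (Pair Nil x) v) y ->
    Ev (psearch p) (Pair x v) y.

(** The opcode and the shape of the input select the clause; the two search
    clauses exclude each other because their premise returns [Nil] in one and a
    successor in the other. *)
Lemma Ev_functional p v y y' : Ev p v y -> Ev p v y' -> y = y'.
Proof.
move=> E; elim: E y' => {p v y}.
- by move=> v y'; inversion 1.
- by move=> x v y'; inversion 1.
- by move=> x v y'; inversion 1.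
- move=> p x v y _ IH y'; inversion 1; subst; exact: IH.
- move=> p q v x y _ IH1 _ IH2 y'; inversion 1; subst.
  by f_equal; [apply: IH1 | apply: IH2].
- move=> p q v w y _ IH1 _ IH2 y'; inversion 1; subst.
  by apply: IH2; rewrite (IH1 w0).
- move=> p q v y _ IH y'; inversion 1; subst; exact: IH.
- move=> p q x v r y _ IH1 _ IH2 y'; inversion 1; subst.
  by apply: IH2; rewrite (IH1 r0).
- move=> p v y _ IH y'; inversion 1; subst; exact: IH.
- move=> p x v _ IH y'; inversion 1; subst => //.
  by match goal with K : Ev p _ _ |- _ => by have := IH _ K end.
- move=> p x v r y _ IH1 _ IH2 y'; inversion 1; subst.
    by match goal with K : Ev p _ _ |- _ => by have := IH1 _ K end.
  exact: IH2.
Qed.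

(** The constructors of [Ev], with variables for their parameters. *)
Definition evaluator : seq clause :=
  let p := Leaf 0 in let q := Leaf 1 in let v := Leaf 2 in
  let x := Leaf 3 in let y := Leaf 4 in let r := Leaf 5 in
  [:: ([::], Judgment pzero v Nil);
      ([::], Judgment psucc (Pair x v) (Pair Nil x));
      ([::], Judgment phead (Pair x v) x);
      ([:: Judgment p v y], Judgment (ptail p) (Pair x v) y);
      ([:: Judgment p v x; Judgment q v y],
        Judgment (pcons p q) v (Pair x y));
      ([:: Judgment q v x; Judgment p x y], Judgment (pcomp p q) v y);
      ([:: Judgment p v y], Judgment (prec p q) (Pair Nil v) y);
      ([:: Judgment (prec p q) (Pair x v) r;
           Judgment q (Pair x (Pair r v)) y],
        Judgment (prec p q) (Pair (Pair Nil x) v) y);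
      ([:: Judgment (psearch p) (Pair Nil v) y], Judgment (pmin p) v y);
      ([:: Judgment p (Pair x v) Nil], Judgment (psearch p) (Pair x v) x);
      ([:: Judgment p (Pair x v) (Pair Nil r);
           Judgment (psearch p) (Pair (Pair Nil x) v) y],
        Judgment (psearch p) (Pair x v) y)].

(** The clauses use only the variables 0 to 5. *)
Lemma evaluator_rule i : i < size evaluator ->
  closed_under (derivable evaluator)
    (nth ([::], Judgment Nil Nil Nil) evaluator i).
Proof.
move=> lti; apply: (@derivable_closed _ 6).
  by move: i lti; apply/all_nthP.
elim: evaluator i lti => //= c H IH [|i] lti; [by left | right].
exact: IH.
Qed.

(** The lists below give the values of the variables p, q, v, x, y, r of
    [evaluator], in this order. *)
Lemma derivable_Ev p v y :
  derivable evaluator (Judgment p v y) <-> Ev p v y.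
Proof.
split=> [d|E].
  pose R j := Ev (prog j) (input j) (output j).
  apply: (derivable_least (R := R)) d => c /=.
  case=> [<- s|]; first exact: Ev_zero.
  case=> [<- s|]; first exact: Ev_succ.
  case=> [<- s|]; first exact: Ev_head.
  case=> [<- s|]; first exact: Ev_tail.
  case=> [<- s|]; first exact: Ev_cons.
  case=> [<- s|]; first exact: Ev_comp.
  case=> [<- s|]; first exact: Ev_rec0.
  case=> [<- s|]; first exact: Ev_recS.
  case=> [<- s|]; first exact: Ev_min.
  case=> [<- s|]; first exact: Ev_found.
  case=> [<- s|]; first exact: Ev_next.
  by case.
elim: E => {p v y}.
- by move=> v;
  apply: (@evaluator_rule 0 isT (nth Nil [:: Nil; Nil; v])).
- by move=> x v;
  apply: (@evaluator_rule 1 isT (nth Nil [:: Nil; Nil; v; x])).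
- by move=> x v;
  apply: (@evaluator_rule 2 isT (nth Nil [:: Nil; Nil; v; x])).
- by move=> p x v y _;
  apply: (@evaluator_rule 3 isT (nth Nil [:: p; Nil; v; x; y])).
- by move=> p q v x y _ + _;
  apply: (@evaluator_rule 4 isT (nth Nil [:: p; q; v; x; y])).
- by move=> p q v x y _ + _;
  apply: (@evaluator_rule 5 isT (nth Nil [:: p; q; v; x; y])).
- by move=> p q v y _;
  apply: (@evaluator_rule 6 isT (nth Nil [:: p; q; v; Nil; y])).
- by move=> p q x v r y _ + _;
  apply: (@evaluator_rule 7 isT (nth Nil [:: p; q; v; x; y; r])).
- by move=> p v y _;
  apply: (@evaluator_rule 8 isT (nth Nil [:: p; Nil; v; Nil; y])).
- by move=> p x v _;
  apply: (@evaluator_rule 9 isT (nth Nil [:: p; Nil; v; x])).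
- by move=> p x v r y _ + _;
  apply: (@evaluator_rule 10 isT (nth Nil [:: p; Nil; v; x; y; r])).
Qed.

(** * Compiling partial recursive functions *)

Fixpoint compile k (f : murec k) : data :=
  match f with
  | MZero _ => pzero
  | MSucc => psucc
  | MProj _ i => iter i (@ptail void) phead
  | MComp _ m f g =>
      pcomp (compile f)
        (foldr (@pcons void) pzero [seq compile (g i) | i <- enum 'I_m])
  | MRec _ f g => prec (compile f) (compile g)
  | MMin _ f => pmin (compile f)
  end.

Definition nums (s : seq nat) : data := foldr (fun n => Pair (num n)) Nil s.

Lemma Ev_proj (s : seq nat) i : i < size s ->
  Ev (iter i (@ptail void) phead) (nums s) (num (nth 0 s i)).
Proof.
elim: i s => [|i IHi] [|n s] //= lti; first exact: Ev_head.
exact/Ev_tail/IHi.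
Qed.

(** [pzero] ends a list of programs because [Nil] is both 0 and the
    empty list. *)
Lemma Ev_args T (p : T -> data) (w : T -> nat) v (s : seq T) :
  (forall i, Ev (p i) v (num (w i))) ->
  Ev (foldr (@pcons void) pzero (map p s)) v (nums (map w s)).
Proof.
move=> E; elim: s => [|i s IHs] /=; first exact: Ev_zero.
exact: Ev_cons.
Qed.

(** For minimization the search is followed backwards from the zero [y]: it
    returns [y] when started at [y - n], by induction on [n]. *)
Lemma Ev_compile k (f : murec k) v y :
  computes f v y -> Ev (compile f) (nums v) (num y).
Proof.
elim: f v y => {k} [k|||k m f IHf g IHg|k f IHf g IHg|k f IHf] /=.
- by move=> v y ->; apply: Ev_zero.
- by move=> v y ->; case/tupleP: v => n v; rewrite theadE; apply: Ev_succ.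
- move=> k i v y ->; rewrite (tnth_nth 0); apply: Ev_proj.
  by rewrite size_tuple.
- move=> v y [w gw fy]; apply: Ev_comp (IHf _ _ fy).
  have -> : val w = [seq tnth w i | i <- enum 'I_m] by rewrite map_tnth_enum.
  by apply: Ev_args => i; apply: IHg.
- move=> v y; case/tupleP: v => n v; rewrite theadE.
  have -> : [tuple of behead [tuple of n :: v]] = v by apply: val_inj.
  rewrite /=; elim: n y => [|n IHn] y /=.
    by move/IHf; apply: Ev_rec0.
  by case=> r /IHn Er /IHg; apply: Ev_recS.
move=> v y [/IHf E0 En]; apply: Ev_min.
have: forall n, n <= y ->
    Ev (psearch (compile f)) (Pair (num (y - n)) (nums v)) (num y).
  elim=> [_|n IHn ltny]; first by rewrite subn0; apply: Ev_found.
  have [|r /IHf Er] := En (y - n.+1); first by rewrite -subSn // subSS leq_subr.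
  apply: Ev_next Er _.
  have -> : Pair Nil (num (y - n.+1)) = num (y - n.+1).+1 :> data by [].
  by rewrite -subSn // subSS; apply: IHn; apply: ltnW.
by move/(_ y (leqnn y)); rewrite subnn.
Qed.

(** * Recursiveness of Goedel numbering *)

Definition comp1 k (f : murec 1) (g : murec k) : murec k :=
  MComp f (fun _ : 'I_1 => g).

Definition comp2 k (f : murec 2) (g h : murec k) : murec k :=
  MComp f (fun i : 'I_2 => if i == 0 :> nat then g else h).

Lemma computes_comp1 k (f : murec 1) (g : murec k) v a y :
  computes g v a -> computes f [tuple a] y -> computes (comp1 f g) v y.
Proof.
by move=> ga fy; exists [tuple a] => // i; rewrite (ord1 i).
Qed.

Lemma computes_comp2 k (f : murec 2) (g h : murec k) v a b y :
  computes g v a -> computes h v b -> computes f [tuple a; b] y ->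
  computes (comp2 f g h) v y.
Proof.
by move=> ga hb fy; exists [tuple a; b] => // -[[|[|i]] lti].
Qed.

Lemma computes_succ k (g : murec k) v a :
  computes g v a -> computes (comp1 MSucc g) v a.+1.
Proof. by move=> ga; apply: computes_comp1 ga _. Qed.

Fixpoint mconst k n : murec k :=
  if n is n'.+1 then comp1 MSucc (mconst k n') else MZero k.

Lemma computes_const k n v : computes (mconst k n) v n.
Proof.
by elim: n => // n IHn; apply: computes_succ.
Qed.

Definition mproj k n : murec k.+1 := MProj (inord n).

Lemma computes_proj k n (v : k.+1.-tuple nat) a :
  n < k.+1 -> nth 0 v n = a -> computes (mproj k n) v a.
Proof. by move=> ltn <-; rewrite /= (tnth_nth 0) inordK. Qed.

Lemma computes_rec k (f : murec k) (g : murec k.+2) v (F : nat -> nat) n :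
  computes f v (F 0) ->
  (forall i, computes g [tuple of i :: F i :: v] (F i.+1)) ->
  computes (MRec f g) [tuple of n :: v] (F n).
Proof.
move=> f0 gS; rewrite /= theadE.
have -> : [tuple of behead [tuple of n :: v]] = v by apply: val_inj.
by elim: n => //= n IHn; exists (F n).
Qed.

Definition mdouble : murec 1 :=
  MRec (MZero 0) (comp1 MSucc (comp1 MSucc (mproj 1 1))).

Lemma computes_double n : computes mdouble [tuple n] n.*2.
Proof.
apply: (computes_rec (v := [tuple]) (F := double)) => // i.
by do 2!apply: computes_succ; apply: computes_proj.
Qed.

(** One step of [CodeSeq.code], which folds the map sending n, m to
    2^n * (2m + 1). *)
Definition mcode : murec 2 :=
  MRec (comp1 MSucc mdouble) (comp1 mdouble (mproj 2 1)).

Lemma computes_code n m : computes mcode [tuple n; m] (2 ^ n * m.*2.+1).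
Proof.
apply: (computes_rec (v := [tuple m]) (F := fun n => 2 ^ n * m.*2.+1)) => [|i].
  by rewrite mul1n; apply/computes_succ/computes_double.
rewrite expnS -mulnA mul2n.
by apply: computes_comp1 (computes_double _); apply: computes_proj.
Qed.

Fixpoint mcodes k (s : seq (murec k)) : murec k :=
  if s is f :: s' then comp2 mcode f (mcodes s') else MZero k.

(** [CodeSeq.code (a :: l)] unfolds to the value computed by [mcode]. *)
Lemma computes_codes_cons k (f : murec k) s v a l :
  computes f v a -> computes (mcodes s) v (CodeSeq.code l) ->
  computes (mcodes (f :: s)) v (CodeSeq.code (a :: l)).
Proof.
by move=> fa sl; apply: computes_comp2 fa sl _; apply: computes_code.
Qed.

Definition mapp k (c : conn tsig) (s : seq (murec k)) : murec k :=
  mcodes (mconst k (enum_rank c).+1 :: s).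

Lemma computes_app k (c : conn tsig) (s : seq (murec k)) A v :
  size A = arity c ->
  computes (mcodes s) v (CodeSeq.code (map (@godel tsig) A)) ->
  computes (mapp c s) v (godel (app c A)).
Proof.
move=> sz sA; rewrite godel_app //; apply: computes_codes_cons sA.
exact: computes_const.
Qed.

Definition mnum : murec 1 :=
  MRec (mapp CNil [::]) (mapp CPair [:: mapp CNil [::]; mproj 1 1]).

Lemma computes_num n : computes mnum [tuple n] (godel (data_fm (num n))).
Proof.
apply: (computes_rec (v := [tuple]) (F := fun n => godel (data_fm (num n)))).
  exact: computes_app.
move=> i; apply: computes_app => //.
apply: computes_codes_cons; first exact: computes_app.
by apply: computes_codes_cons => //; apply: computes_proj.
Qed.

(** * The diagonal argument *)

(** The self-referential question: the number fed to [p] is a code of [p]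
    itself, so that a decision procedure composed with [mself_query] is asked
    about its own behaviour. *)
Definition self_query (p : data) : formula tsig :=
  ground_fm (Judgment p (nums [:: godel (data_fm p)]) Nil).

Definition mself_query : murec 1 :=
  mapp CEval
    [:: mproj 0 0; mapp CPair [:: mnum; mapp CNil [::]]; mapp CNil [::]].

Lemma computes_self_query p :
  computes mself_query [tuple godel (data_fm p)] (godel (self_query p)).
Proof.
apply: computes_app => //.
apply: computes_codes_cons; first exact: computes_proj.
apply: computes_codes_cons.
  apply: computes_app => //; apply: computes_codes_cons (computes_num _) _.
  by apply: computes_codes_cons => //; apply: computes_app.
by apply: computes_codes_cons => //; apply: computes_app.
Qed.

Theorem mainTheorem1 :
  exists (S : signature) (P : seq (formula S)), ~ decidable_calculus P.
Proof.
exists tsig, (axioms evaluator); case=> f f_decides.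
pose p := compile (comp1 f mself_query).
have [b [fb bP]] := f_decides (self_query p).
have Eb : Ev p (nums [:: godel (data_fm p)]) (num b).
  apply: (@Ev_compile 1 _ [tuple godel (data_fm p)]).
  exact: computes_comp1 (computes_self_query p) fb.
case: b bP Eb {fb} => bP Eb; last first.
  by case: bP => _ /(_ (iffRL (derivable_Ev _ _ _) Eb)).
have E0 := iffLR (derivable_Ev _ _ _) (iffLR bP isT).
by have := Ev_functional Eb E0.
Qed.
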